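(* Let $G$ be a connected $(P_7, C_4, \text{diamond})$-free graph that has no clique cutset. If $G$ is isomorphic neither to $F$ nor to the Petersen graph, then $\delta(G)\le \max\{2,\omega(G)-1\}$.
   Context: All graphs are finite and simple. $P_t$ and $C_t$ denote the path and the cycle on $t$ vertices. For a graph $H$, a graph $G$ is $H$-free if no induced subgraph of $G$ is isomorphic to $H$; $G$ is $(H_1,H_2,\dots)$-free if it is $H_i$-free for every $i$. A diamond is the graph obtained from two triangles sharing exactly one edge (i.e. $K_4$ minus an edge). A clique cutset of $G$ is a clique $K$ of $G$ such that $G-K$ has more connected components than $G$. $\delta(G)$ is the minimum degree and $\omega(G)$ the clique number. The graph $F$ is obtained from a $7$-hole (induced cycle) $v_1v_2v_3v_4v_5v_6v_7v_1$ by adding a stable set $\{y_1,y_2,y_3\}$ with $N(y_1)=\{v_1,v_4,v_5\}$, $N(y_2)=\{v_2,v_5,v_6\}$, $N(y_3)=\{v_3,v_6,v_7\}$ and no other edges. *)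

(* Defs.v *)
(* Simple graphs: a symmetric irreflexive relation e on a finType T. *)
From mathcomp Require Import all_boot.
Set Implicit Arguments. Unset Strict Implicit. Unset Printing Implicit Defensive.

Definition mkg (n : nat) (E : seq (nat * nat)) : rel 'I_n :=
  fun i j => ((val i, val j) \in E) || ((val j, val i) \in E).
Arguments mkg : clear implicits.

Definition P7 : rel 'I_7 := mkg 7 [:: (0,1); (1,2); (2,3); (3,4); (4,5); (5,6)].
Definition C4 : rel 'I_4 := mkg 4 [:: (0,1); (1,2); (2,3); (3,0)].
(* diamond = K4 minus the edge {2,3} *)
Definition diamond : rel 'I_4 := mkg 4 [:: (0,1); (0,2); (0,3); (1,2); (1,3)].
(* F: v1..v7 are 0..6 (7-hole), y1,y2,y3 are 7,8,9 *)
Definition Fgraph : rel 'I_10 := mkg 10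
  [:: (0,1); (1,2); (2,3); (3,4); (4,5); (5,6); (6,0);
      (7,0); (7,3); (7,4);
      (8,1); (8,4); (8,5);
      (9,2); (9,5); (9,6)].
(* Petersen: outer 5-cycle 0..4, spokes i--i+5, inner pentagram on 5..9 *)
Definition Petersen : rel 'I_10 := mkg 10
  [:: (0,1); (1,2); (2,3); (3,4); (4,0);
      (0,5); (1,6); (2,7); (3,8); (4,9);
      (5,7); (7,9); (9,6); (6,8); (8,5)].

Section Graph.
Variables (T : finType) (e : rel T).

Definition has_induced (n : nat) (h : rel 'I_n) : Prop :=
  exists f : 'I_n -> T, injective f /\ forall i j, e (f i) (f j) = h i j.

Definition Hfree (n : nat) (h : rel 'I_n) : Prop := ~ has_induced h.

Definition isomorphic_to (n : nat) (h : rel 'I_n) : Prop :=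
  exists f : 'I_n -> T, bijective f /\ forall i j, e (f i) (f j) = h i j.

Definition connected : Prop := 0 < #|T| /\ forall x y, connect e x y.

Definition is_clique (K : {set T}) : bool :=
  [forall x in K, forall y in K, (x != y) ==> e x y].

Definition ncomp (S : {set T}) : nat :=
  let eS := [rel x y | [&& x \in S, y \in S & e x y]] in
  #|[set [set y in S | connect eS x y] | x in S]|.

Definition clique_cutset (K : {set T}) : Prop :=
  is_clique K /\ ncomp [set: T] < ncomp (~: K).

Definition has_clique_cutset : Prop := exists K, clique_cutset K.

Definition deg (x : T) : nat := #|[set y | e x y]|.

Definition min_degree : nat := \big[minn/#|T|]_(x : T) deg x.

Definition clique_number : nat := \max_(K : {set T} | is_clique K) #|K|.

End Graph.

(* Main.v *)
(** In a counterexample every vertex has degree at least 3, and every edge [uv]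
    has a neighbor [y] of [v] outside [N[u]]: otherwise, [G] being diamond-free,
    [N[v]] is a clique, so that [deg v <= omega - 1].  Starting from a small
    induced subgraph, whenever one of these two requirements fails inside the
    subgraph there must be a further vertex, and the forbidden subgraphs leave
    few possibilities for its adjacencies.  Branching on them closes after
    finitely many steps: the search kills every proper connected extension of
    the Petersen graph, then holes of length 7, 6 (which lead only to the
    Petersen graph) and 5, and finally a single edge. *)
Require Import Defs.
From mathcomp Require Import all_boot.
Set Implicit Arguments. Unset Strict Implicit. Unset Printing Implicit Defensive.

(** * Search *)

(* A graph on a list of vertices is coded by the rows of adjacencies of each
   vertex to the later ones; the search adds new vertices at the head. *)
Fixpoint code (U : Type) (r : rel U) (s : seq U) : seq bitseq :=
  if s is x :: s' then map (r x) s' :: code r s' else [::].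

Definition adj (m : seq bitseq) (i j : nat) : bool :=
  if i < j then nth false (nth [::] m i) (j - i.+1)
  else if j < i then nth false (nth [::] m j) (i - j.+1) else false.

(* The nested conditionals below, instead of [&&], keep call-by-value
   evaluation from exploring both sides. *)
Fixpoint agrees (m : seq bitseq) (i : nat) (t : seq nat) (r : bitseq) : bool :=
  match t, r with
  | j :: t', b :: r' => if adj m i j == b then agrees m i t' r' else false
  | [::], [::] => true
  | _, _ => false
  end.

Fixpoint embeds (m : seq bitseq) (t : seq nat) (p : seq bitseq) : bool :=
  if p is r :: p' then
    has (fun i => if agrees m i t r then
                    if i \in t then false else embeds m (i :: t) p'
                  else false)
      (iota 0 (size m))
  else true.

(* Only copies whose first vertex is the newest one are looked for: the others
   were excluded before that vertex was added. *)
Definition avoids (ps : seq (seq bitseq)) (m : seq bitseq) : bool :=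
  all (fun p => ~~ embeds m [:: 0] p) ps.

Fixpoint rows (ps : seq (seq bitseq)) (m : seq bitseq) : seq bitseq :=
  if m is _ :: m' then
    [seq r <- [seq b :: r | r <- rows ps m', b <- [:: true; false]]
     | avoids ps (r :: m)]
  else [:: [::]].

Definition stuck_edges (m : seq bitseq) : seq (nat * nat) :=
  let ns := iota 0 (size m) in
  [seq vu <- [seq (v, u) | v <- ns, u <- ns]
   | adj m vu.1 vu.2
     && all (fun w => adj m vu.1 w ==> (w == vu.2) || adj m w vu.2) ns].

Definition poor_vertices (m : seq bitseq) : seq nat :=
  let ns := iota 0 (size m) in [seq v <- ns | count (adj m v) ns < 3].

(* [ps] prunes partial rows and [qs], costlier to test, only complete ones. *)
Definition all_extensions (ps qs : seq (seq bitseq)) (m : seq bitseq)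
    (c : pred bitseq) (P : pred (seq bitseq)) : bool :=
  all (fun r => if c r then if avoids qs (r :: m) then P (r :: m) else true
                else true)
    (rows ps m).

(** The fuel [k] bounds the number of nested branchings. A branch closes when no row survives
    pruning; exhausted fuel, or a graph where both requirements hold, gives [false]. Stuck edges
    come first since they fix two entries of the new row instead of one. *)
Fixpoint refutes (ps qs : seq (seq bitseq)) (k : nat) (m : seq bitseq) : bool :=
  if k is k'.+1 then
    if stuck_edges m is (v, u) :: _ then
      all_extensions ps qs m (fun r => nth false r v && ~~ nth false r u)
        (refutes ps qs k')
    else if poor_vertices m is v :: _ then
      all_extensions ps qs m (fun r => nth false r v) (refutes ps qs k')
    else false
  else false.

Definition edge (E : seq (nat * nat)) : rel nat :=
  fun i j => ((i, j) \in E) || ((j, i) \in E).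

(* The row of the first vertex embedded, the last one of [t], is empty and
   dropped. *)
Definition pattern (E : seq (nat * nat)) (t : seq nat) : seq bitseq :=
  behead (rev (code (edge E) t)).

Definition path_edges n := [seq (i, i.+1) | i <- iota 0 n.-1].
Definition cycle_edges n := rcons (path_edges n) (n.-1, 0).
Definition diamond_edges := [:: (0,1); (0,2); (0,3); (1,2); (1,3)].
Definition Petersen_edges :=
  [:: (0,1); (1,2); (2,3); (3,4); (4,0);
      (0,5); (1,6); (2,7); (3,8); (4,9);
      (5,7); (7,9); (9,6); (6,8); (8,5)].

Definition cycle_pattern n := pattern (cycle_edges n) (iota 0 n).
Definition Petersen_pattern := pattern Petersen_edges (iota 0 10).

(* One pattern for each orbit of vertices of the forbidden graph. *)
Definition small_patterns :=
  [:: cycle_pattern 4; pattern diamond_edges (iota 0 4);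
      pattern diamond_edges (rev (iota 0 4))].
(** Embedding starts at [k], climbs to [6], then descends from [k - 1] to [0], so each new vertex
    has a neighbor already placed. *)
Definition P7_patterns :=
  [seq pattern (path_edges 7) (iota 0 k ++ rev (iota k (7 - k))) | k <- iota 0 4].

Lemma agreesE m i t r : agrees m i t r = (map (adj m i) t == r).
Proof.
elim: t r => [|j t IHt] [|b r] //=.
by rewrite eqseq_cons -IHt; case: eqP.
Qed.

Lemma embedsP m t p : embeds m t p ->
  uniq t -> all (fun i => i < size m) t ->
  exists t', [/\ uniq t', all (fun i => i < size m) t'
                & code (adj m) t' = catrev p (code (adj m) t)].
Proof.
elim: p t => [|r p IHp] t /=; first by exists t.
case/hasP=> i; rewrite mem_iota add0n => /= lt_i.
rewrite agreesE; case: eqP => // def_r; case: ifP => // t'i emb_p Ut lt_t.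
by have [||t' [Ut' lt_t' def_t']] := IHp _ emb_p;
  rewrite /= ?t'i ?lt_i //; exists t'; rewrite def_t' /= def_r.
Qed.

(** * Vertex lists of a graph and soundness of the enumeration of rows *)

Section Code.

Variables (U : eqType) (r : rel U).
Hypotheses (r_sym : symmetric r) (r_irr : irreflexive r).

Lemma size_code s : size (code r s) = size s.
Proof. by elim: s => //= x s ->. Qed.

Lemma nth_code x0 s i : i < size s ->
  nth [::] (code r s) i = map (r (nth x0 s i)) (drop i.+1 s).
Proof.
by elim: s i => [|x s IHs] [|i] //= lt_i; rewrite ?drop0 // IHs.
Qed.

Lemma adj_code x0 s i j : i < size s -> j < size s ->
  adj (code r s) i j = r (nth x0 s i) (nth x0 s j).
Proof.
move=> lt_i lt_j; rewrite /adj; case: ltngtP => [lt_ij|lt_ji|->].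
- rewrite (nth_code x0) // (nth_map x0) ?nth_drop ?subnKC //.
  by rewrite size_drop ltn_sub2r // (leq_ltn_trans lt_ij).
- rewrite (nth_code x0) // (nth_map x0) ?nth_drop ?subnKC //.
  by rewrite size_drop ltn_sub2r // (leq_ltn_trans lt_ji).
- by rewrite r_irr.
Qed.

Lemma code_nth x0 s t : all (fun i => i < size s) t ->
  code r (map (nth x0 s) t) = code (adj (code r s)) t.
Proof.
elim: t => //= i t IHt /andP[lt_i lt_t]; rewrite IHt //; congr (_ :: _).
rewrite -map_comp; apply/eq_in_map => j /(allP lt_t) lt_j /=.
by rewrite -adj_code.
Qed.

(** [catrev] undoes the reversal made by [pattern], and the singleton restores the dropped empty
    row. *)
Definition omits (p : seq bitseq) : Prop :=
  forall s, uniq s -> code r s <> catrev p [:: [::]].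

Lemma omits_avoids ps x s : (forall p, p \in ps -> omits p) ->
  uniq (x :: s) -> avoids ps (code r (x :: s)).
Proof.
move=> omit_ps Us; apply/allP=> p /omit_ps omit_p.
apply/negP=> /embedsP[] // t [Ut lt_t def_t].
rewrite size_code in lt_t; apply: (omit_p (map (nth x (x :: s)) t)).
  rewrite map_inj_in_uniq // => i j /(allP lt_t) lt_i /(allP lt_t) lt_j /eqP.
  by rewrite nth_uniq // => /eqP.
by rewrite code_nth.
Qed.

(** Pruning cannot lose the true row of [y]: each truncation of it heads the code of [y] followed by
    a suffix of [s], again a list of distinct vertices. *)
Lemma mem_rows ps y s : (forall p, p \in ps -> omits p) ->
  uniq (y :: s) -> map (r y) s \in rows ps (code r s).
Proof.
move=> omit_ps; elim: s => [|x s IHs] // Us.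
rewrite [rows _ _]/= mem_filter -/(code r (x :: s)) -/(code r (y :: x :: s)).
rewrite omits_avoids //=; apply/flatten_mapP.
exists (map (r y) s); last by case: (r y x); rewrite !inE eqxx ?orbT.
by apply: IHs; move: Us => /= /and3P[]; rewrite inE => /norP[_ ->] _ ->.
Qed.

Lemma all_extensionsP ps qs c P y s :
  (forall p, p \in ps ++ qs -> omits p) ->
  all_extensions ps qs (code r s) c P -> uniq (y :: s) ->
  c (map (r y) s) -> P (code r (y :: s)).
Proof.
move=> omit /allP ext Us cy.
have := ext (map (r y) s); rewrite cy -/(code r (y :: s)) omits_avoids //.
  by apply; apply: mem_rows => // p p_ps; apply: omit; rewrite mem_cat p_ps.
by move=> p p_qs; apply: omit; rewrite mem_cat p_qs orbT.
Qed.

End Code.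

Lemma edge_sym E : symmetric (edge E).
Proof. by move=> i j; rewrite /edge orbC. Qed.

Lemma edge_irr E : all (fun ij => ij.1 != ij.2) E -> irreflexive (edge E).
Proof.
move=> /allP loopless i; rewrite /edge orbb.
by apply/negP=> /loopless; rewrite eqxx.
Qed.

(** * Soundness of the refutation search *)

Section Refutation.

Variables (T : finType) (e : rel T).
Hypotheses (e_sym : symmetric e) (e_irr : irreflexive e).

(** Vertex [i] of the pattern goes to the entry of [s] at the position of [i] in [t]. *)
Lemma code_has_induced n E s t :
  all (fun ij => ij.1 != ij.2) E -> perm_eq t (iota 0 n.+1) -> uniq s ->
  code e s = code (edge E) t -> has_induced e (mkg n.+1 E).
Proof.
move=> loopless perm_t Us def_s.
have sz_t : size t = n.+1 by rewrite (perm_size perm_t) size_iota.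
have sz_s : size s = n.+1 by rewrite -(size_code e) def_s size_code.
case: s sz_s Us def_s => // x s sz_s Us def_s.
have t_i (i : 'I_n.+1) : val i \in t by rewrite (perm_mem perm_t) mem_iota /=.
have lt_i (i : 'I_n.+1) : index (val i) t < n.+1.
  by move: (t_i i); rewrite -index_mem sz_t.
exists (fun i : 'I_n.+1 => nth x (x :: s) (index (val i) t)); split=> [i j|i j].
  move/eqP; rewrite nth_uniq ?sz_s // => /eqP eq_ij.
  by apply: val_inj; rewrite -(nth_index 0 (t_i i)) eq_ij nth_index.
rewrite -(adj_code e_sym e_irr) ?sz_s // def_s.
rewrite (adj_code (@edge_sym E) (edge_irr loopless) 0) ?sz_t //.
by rewrite !nth_index.
Qed.

Lemma Hfree_omits n E t : Hfree e (mkg n.+1 E) ->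
  all (fun ij => ij.1 != ij.2) E -> perm_eq t (iota 0 n.+1) ->
  last [::] (code (edge E) t) = [::] -> omits e (pattern E t).
Proof.
move=> free_E loopless perm_t last_t s Us def_s.
apply/free_E/(code_has_induced loopless perm_t Us); rewrite def_s.
have: code (edge E) t != [::].
  by rewrite -size_eq0 size_code (perm_size perm_t) size_iota.
rewrite /pattern; case/lastP: (code _ t) last_t => // c r.
by rewrite last_rcons => -> _; rewrite rev_rcons /= catrevE revK cats1.
Qed.

Hypothesis e_leave : forall u v, e u v -> exists y, [&& e v y, y != u & ~~ e y u].
Hypothesis e_deg : forall v, 2 < deg e v.

(** Induction on [k]: [e_leave] or [e_deg] supplies a vertex outside the list that repairs the
    defect branched on; its row is among those enumerated, and the longer list falls under the
    induction hypothesis. *)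
Lemma refutesP ps qs k s : (forall p, p \in ps ++ qs -> omits e p) ->
  uniq s -> ~~ refutes ps qs k (code e s).
Proof.
move=> omit; elim: k s => [|k IHk] [|x s] //; move: (x :: s) => s' Us /=.
have step y (c : pred bitseq) : uniq (y :: s') -> c (map (e y) s') ->
    ~~ all_extensions ps qs (code e s') c (refutes ps qs k).
  move=> Uys cy; apply/negP=> /(all_extensionsP e_sym e_irr omit)/(_ Uys cy).
  by apply/negP/IHk.
have adjE i j : i < size s' -> j < size s' ->
    adj (code e s') i j = e (nth x s' i) (nth x s' j).
  exact: adj_code.
case def_se: (stuck_edges _) => [|[v u] se].
  case def_pv: (poor_vertices _) => [|v pv] //.
  have: v \in poor_vertices (code e s') by rewrite def_pv mem_head.
  rewrite mem_filter mem_iota size_code add0n => /and3P[few_v _ lt_v].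
  (* If all neighbors lay in [s'], the degree would be at most the count found by the search, which
     is below 3. *)
  have [y]: exists y, e (nth x s' v) y && (y \notin s').
    apply/existsP; apply: contraLR (e_deg (nth x s' v)) => /existsPn near.
    rewrite -leqNgt -ltnS (leq_trans _ few_v) // ltnS.
    have: {subset enum [set y | e (nth x s' v) y]
             <= filter (e (nth x s' v)) s'}.
      move=> y; rewrite mem_enum inE mem_filter => evy; rewrite evy /=.
      by have:= near y; rewrite evy /= negbK.
    move/(uniq_leq_size (enum_uniq _)); rewrite -cardE => /leq_trans-> //.
    rewrite size_filter -[X in count _ X](mkseq_nth x) /mkseq count_map.
    rewrite leq_eqVlt; apply/orP; left; apply/eqP/eq_in_count => j.
    by rewrite mem_iota add0n => /= lt_j; rewrite adjE.
  case/andP=> evy ys; apply: (step y); first by rewrite cons_uniq ys.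
  by rewrite (nth_map x) // e_sym.
have: (v, u) \in stuck_edges (code e s') by rewrite def_se mem_head.
rewrite mem_filter size_code => /andP[/andP[/= vu /allP stuck_v]].
case/allpairsP=> -[v0 u0] [/= + + [def_v def_u]].
rewrite -def_v -def_u !mem_iota !add0n => /= lt_v lt_u.
rewrite adjE // e_sym in vu; have [y /and3P[evy y'u eyu]] := e_leave vu.
apply: (step y); last first.
  by rewrite !(nth_map x) // e_sym evy eyu.
(* A [y] already listed would have to be [u] or adjacent to [u], because the edge is stuck. *)
rewrite cons_uniq Us andbT; apply/negP=> /(nthP x)[w lt_w def_y].
have := stuck_v w; rewrite mem_iota add0n !adjE //= def_y evy (negPf eyu) orbF.
move=> /(_ lt_w) /eqP def_w; by rewrite -def_y def_w eqxx in y'u.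
Qed.

End Refutation.

(** * The computed refutations *)

Lemma C7_refuted :
  refutes small_patterns P7_patterns 5 (code (edge (cycle_edges 7)) (iota 0 7)).
Proof. by vm_compute. Qed.

Lemma Petersen_extensions_refuted :
  all_extensions small_patterns P7_patterns
    (code (edge Petersen_edges) (iota 0 10)) (fun r => true \in r)
    (refutes small_patterns P7_patterns 4).
Proof. by vm_compute. Qed.

Lemma C6_refuted :
  refutes small_patterns [:: Petersen_pattern, cycle_pattern 7 & P7_patterns] 7
    (code (edge (cycle_edges 6)) (iota 0 6)).
Proof. by vm_compute. Qed.

Lemma C5_refuted :
  refutes small_patterns [:: cycle_pattern 6, cycle_pattern 7 & P7_patterns] 6
    (code (edge (cycle_edges 5)) (iota 0 5)).
Proof. by vm_compute. Qed.

Lemma K2_refuted :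
  refutes small_patterns
    [:: cycle_pattern 5, cycle_pattern 6, cycle_pattern 7 & P7_patterns] 6
    (code (edge [:: (0, 1)]) (iota 0 2)).
Proof. by vm_compute. Qed.

(** * Degrees *)

Lemma min_degree_le (T : finType) (e : rel T) x : min_degree e <= deg e x.
Proof.
rewrite /min_degree; elim: (index_enum T) (mem_index_enum x) => //= y r IHr.
rewrite big_cons inE => /orP[/eqP<- | /IHr]; first exact: geq_minl.
by apply: leq_trans; apply: geq_minr.
Qed.

(** Two nonadjacent neighbors [a], [b] of [v] would form with [u] and [v] a diamond whose two
    triangles share the edge [uv]; hence the closed neighborhood of [v] is a clique. *)
Lemma deg_lt_clique_number (T : finType) (e : rel T) u v :
  symmetric e -> irreflexive e -> Hfree e diamond -> e u v ->
  (forall y, e v y -> y != u -> e y u) -> deg e v < clique_number e.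
Proof.
move=> e_sym e_irr free_d uv near_u; pose N := [set y | e v y].
have -> : (deg e v).+1 = #|v |: N| by rewrite cardsU1 inE e_irr.
apply: leq_bigmax_cond; apply/forall_inP=> a; rewrite !inE => Na.
apply/forall_inP=> b; rewrite !inE => Nb; apply/implyP=> ab.
have [def_a|av] := eqVneq a v.
  by rewrite def_a in ab *; case/orP: Nb => // /eqP def_b;
     rewrite def_b eqxx in ab.
rewrite (negPf av) /= in Na; have [def_b|bv] := eqVneq b v.
  by rewrite def_b e_sym.
rewrite (negPf bv) /= in Nb; have [def_a|au] := eqVneq a u.
  by rewrite def_a e_sym near_u // -def_a eq_sym.
have [def_b|bu] := eqVneq b u; first by rewrite def_b near_u.
have ua : e u a by rewrite e_sym near_u.
have ub : e u b by rewrite e_sym near_u.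
have uv_neq : u != v by apply: contraTneq uv => ->; rewrite e_irr.
apply/negPn/negP=> /negPf ab'; apply: free_d.
apply: (@code_has_induced _ e e_sym e_irr 3 diamond_edges
          [:: u; v; a; b] (iota 0 4)) => //.
  by rewrite /= !inE !negb_or uv_neq !(eq_sym u) !(eq_sym v) au bu av bv ab.
by rewrite /= uv ua ub Na Nb ab'.
Qed.

(** * Configurations omitted by a counterexample *)

Section Main.

Variables (T : finType) (e : rel T).
Hypotheses (e_sym : symmetric e) (e_irr : irreflexive e).
Hypotheses (free_P7 : Hfree e P7) (free_C4 : Hfree e C4).
Hypothesis free_diamond : Hfree e diamond.
Hypothesis e_leave : forall u v, e u v -> exists y, [&& e v y, y != u & ~~ e y u].
Hypothesis e_deg : forall v, 2 < deg e v.

Lemma omits_basic p : p \in small_patterns ++ P7_patterns -> omits e p.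
Proof.
have omit_P7 t : perm_eq t (iota 0 7) ->
    last [::] (code (edge (path_edges 7)) t) = [::] ->
    omits e (pattern (path_edges 7) t).
  by apply: Hfree_omits.
have omit_d t : perm_eq t (iota 0 4) ->
    last [::] (code (edge diamond_edges) t) = [::] ->
    omits e (pattern diamond_edges t).
  by apply: Hfree_omits.
rewrite mem_cat => /orP[|/mapP[k]].
  rewrite !inE => /or3P[] /eqP->; [|exact: omit_d..].
  exact: (@Hfree_omits _ _ e_sym e_irr 3 (cycle_edges 4)).
by rewrite !inE => /or4P[] /eqP-> ->; apply: omit_P7.
Qed.

Lemma omits_refuted qs k E n :
  (forall p, p \in qs -> omits e p) ->
  refutes small_patterns (qs ++ P7_patterns) k (code (edge E) (iota 0 n)) ->
  catrev (pattern E (iota 0 n)) [:: [::]] = code (edge E) (iota 0 n) ->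
  omits e (pattern E (iota 0 n)).
Proof.
move=> omit_qs ref_n def_c s Us def_s; move: ref_n; rewrite -def_c -def_s.
apply/negP/refutesP=> // p; rewrite catA mem_cat mem_cat => /orP[/orP[]|] p_in.
- by apply: omits_basic; rewrite mem_cat p_in.
- exact: omit_qs.
- by apply: omits_basic; rewrite mem_cat p_in orbT.
Qed.

(** Since every extension by an adjacent vertex is refuted, a copy is closed under adjacency;
    connectedness makes it the whole graph. *)
Lemma omits_Petersen :
  connected e -> ~ isomorphic_to e Petersen -> omits e Petersen_pattern.
Proof.
move=> [_ e_conn] not_iso s Us def_s.
have sz_s : size s = 10 by rewrite -(size_code e) def_s.
have s_closed y z : e y z -> y \in s -> z \in s.
  move=> yz ys; apply: contraLR Petersen_extensions_refuted => zs.
  have -> : code (edge Petersen_edges) (iota 0 10) = code e s by rewrite def_s.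
  apply/negP=> /(all_extensionsP e_sym e_irr omits_basic (y := z)).
  rewrite cons_uniq zs Us => /(_ isT); have -> : true \in map (e z) s.
    by apply/mapP; exists y; rewrite // e_sym yz.
  by move/(_ isT); apply/negP/refutesP; rewrite //= ?zs //; apply: omits_basic.
have s_full z : z \in s.
  have closed_s : closed e (mem s).
    by move=> a b ab; apply/idP/idP; apply: s_closed; rewrite // e_sym.
  case: s sz_s closed_s {s_closed Us def_s} => // x s _ closed_s.
  by rewrite -(closed_connect closed_s (e_conn x z)) mem_head.
have [f [f_inj f_e]] : has_induced e Petersen.
  by apply: (@code_has_induced _ e e_sym e_irr 9 Petersen_edges s (iota 0 10)).
apply: not_iso; exists f; split=> //; apply: inj_card_bij => //.
rewrite card_ord -sz_s -(card_uniqP Us) leq_eqVlt; apply/orP; left.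
by apply/eqP/eq_card => z; rewrite s_full.
Qed.

End Main.

Theorem theorem1p1 (T : finType) (e : rel T) :
  symmetric e -> irreflexive e ->
  connected e ->
  Hfree e P7 -> Hfree e C4 -> Hfree e diamond ->
  ~ has_clique_cutset e ->
  ~ isomorphic_to e Fgraph -> ~ isomorphic_to e Petersen ->
  min_degree e <= maxn 2 (clique_number e - 1).
Proof.
move=> e_sym e_irr e_conn free_P7 free_C4 free_d _ _ not_Petersen.
(* The minimum degree now exceeds both 2, giving [e_deg], and [clique_number e - 1], giving
   [e_leave]. *)
rewrite leqNgt; apply/negP=> large_deg.
have e_deg v : 2 < deg e v.
  apply: leq_trans (min_degree_le e v); apply: leq_ltn_trans large_deg.
  exact: leq_maxl.
have e_leave u v : e u v -> exists y, [&& e v y, y != u & ~~ e y u].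
  move=> uv; apply/existsP; apply: contraTT (min_degree_le e v) => near.
  rewrite -ltnNge; apply: leq_ltn_trans large_deg.
  have lt_omega : deg e v < clique_number e.
    apply: (deg_lt_clique_number e_sym e_irr free_d uv) => y vy yu.
    by have /existsPn/(_ y) := near; rewrite vy yu /= negbK.
  by rewrite leq_max subn1 -[_ <= _.-1]ltnS (ltn_predK lt_omega) lt_omega orbT.
have omit := omits_refuted e_sym e_irr free_P7 free_C4 free_d e_leave e_deg.
(* Each configuration, once omitted, prunes later searches. The Petersen graph contains 6-holes, so
   it is excluded before them. *)
have omit7 : omits e (cycle_pattern 7) by apply: (omit [::]) C7_refuted _.
have omitP : omits e Petersen_pattern by apply: omits_Petersen.
have omit6 : omits e (cycle_pattern 6).
  apply: (omit [:: Petersen_pattern; cycle_pattern 7]) C6_refuted _ => // p.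
  by rewrite !inE => /orP[] /eqP->.
have omit5 : omits e (cycle_pattern 5).
  apply: (omit [:: cycle_pattern 6; cycle_pattern 7]) C5_refuted _ => // p.
  by rewrite !inE => /orP[] /eqP->.
have [x _] : exists x : T, x \in T by apply/card_gt0P; case: e_conn.
have [y xy] : exists y, e x y.
  have /card_gt0P[y] : 0 < deg e x by apply: leq_trans (e_deg x).
  by rewrite inE; exists y.
have omitK2 : omits e (pattern [:: (0, 1)] (iota 0 2)).
  apply: (omit [:: cycle_pattern 5; cycle_pattern 6; cycle_pattern 7])
    K2_refuted _ => // p.
  by rewrite !inE => /or3P[] /eqP->.
apply: (omitK2 [:: x; y]); last by rewrite /= xy.
by rewrite /= inE andbT; apply: contraTneq xy => ->; rewrite e_irr.
Qed.
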